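(* Let $a$ be a nonzero real constant. For $i=1,\ldots,N$, one has that $$\max_{t_{i-1}\le t\le t_i} |u_{L^2}(t)| = \begin{cases} \dfrac{2}{1 + e^{a(t_i-t_{i-1})}}\,\alpha^{[i]}, & \text{if } a<0,\\[3mm] \dfrac{2\,e^{a(t_i-t_{i-1})}}{1 + e^{a(t_i-t_{i-1})}}\,\alpha^{[i]}, & \text{if } a>0.\end{cases}$$ It follows that, whenever $\alpha^{[i]}>0$, $$\alpha^{[i]} < \max_{t_{i-1}\le t\le t_{i}} |u_{L^2}(t)|$$ for any $a\neq0$.
   Context: Let $0=t_0<t_1<\cdots<t_N=:t_f$ and let $z_0,\ldots,z_N\in\mathbb{R}$ satisfy $z_i\ne z_{i-1}$, $i=1,\ldots,N$. For the Dahlquist test problem $\dot z(t)=a\,z(t)$, $z(0)=z_0$, with skeleton $\{z_0,\ldots,z_N\}$ at the nodes $t_i$, the residual $u_{L^2}$ of minimal $L^2$-norm (i.e., minimizing $\frac12\sum_i\int_{t_{i-1}}^{t_i}|\dot x-ax|^2dt$ over interpolants $x$ with $x(t_i)=z_i$) is, on each stage $[t_{i-1},t_i]$, $$u_{L^2}(t) = -2a\,\frac{z_i - e^{a(t_i-t_{i-1})}z_{i-1}}{1 - e^{2a(t_i-t_{i-1})}}\,e^{a(t_i-t)},$$ and the residual minimizing the stage $L^\infty$-norm (i.e., minimizing $\sum_i\operatorname{ess\,sup}_{[t_{i-1},t_i]}|\dot x-ax|$ over such interpolants) is constant on each stage, with absolute value $$\alpha^{[i]} = \left|a\,\frac{z_{i}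 - e^{a(t_i-t_{i-1})} z_{i-1}}{1 - e^{a(t_i-t_{i-1})}}\right|.$$ On stage $i$, $u_{L^2}$ is given by $u_{L^2}(t) = -2a\,\frac{z_i - e^{a(t_i-t_{i-1})}z_{i-1}}{1 - e^{2a(t_i-t_{i-1})}}\,e^{a(t_i-t)}$ on the closed interval $[t_{i-1},t_i]$. *)

(* Defs.v *)
From mathcomp Require Import all_boot all_order all_algebra.
From mathcomp Require Import all_classical all_reals all_analysis.

Set Implicit Arguments.
Unset Strict Implicit.
Unset Printing Implicit Defensive.

Import Order.TTheory GRing.Theory Num.Theory.
Local Open Scope classical_set_scope.
Local Open Scope ring_scope.

(* The nodes and the skeleton are maps t, z : nat -> R of which only the
   values at 0, ..., N matter.  Stage i (1 <= i <= N) is the closed interval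
   [t (i-1), t i], and stage-dependent quantities take i as an argument:
   a residual has in general different one-sided limits at a node, so both
   end points of a stage are evaluated with the formula of that stage. *)

Definition stage (R : realType) (t : nat -> R) (i : nat) : set R :=
  `[t i.-1, t i].

(* The minimizer of the sum over i of (1/2) int_[t (i-1), t i] |x' - a x|^2
   among the residuals x' - a x of interpolants x with x (t i) = z i,
   written in closed form on stage i. *)
Definition uL2 (R : realType) (a : R) (t z : nat -> R) (i : nat) (s : R) : R :=
  - 2 * a * ((z i - expR (a * (t i - t i.-1)) * z i.-1)
             / (1 - expR (2 * a * (t i - t i.-1)))) * expR (a * (t i - s)).

(* Absolute value on stage i of the (stagewise constant) residual minimizing
   the sum over i of ess sup_[t (i-1), t i] |x' - a x|, in closed form. *)
Definition alpha (R : realType) (a : R) (t z : nat -> R) (i : nat) : R :=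
  `|a * ((z i - expR (a * (t i - t i.-1)) * z i.-1) / (1 - expR (a * (t i - t i.-1))))|.

(* An attained upper bound, i.e. a maximum and not only a supremum. *)
Definition is_max_on (R : realType) (A : set R) (f : R -> R) (M : R) : Prop :=
  (exists2 s, A s & f s = M) /\ (forall s, A s -> f s <= M).

(* Main.v *)
(* With h = t i - t (i-1), since 1 - e^(2ah) = (1 - e^(ah)) (1 + e^(ah)), on stage i
   |uL2 s| = 2 / (1 + e^(ah)) * alpha * e^(a (t i - s)), which is monotone in s
   and hence maximal at t i if a < 0 and at t (i-1) if a > 0. *)
Require Import Defs.
From mathcomp Require Import all_boot all_order all_algebra.
From mathcomp Require Import all_classical all_reals all_analysis.
From mathcomp Require Import ring lra.

Set Implicit Arguments.
Unset Strict Implicit.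
Unset Printing Implicit Defensive.

Import Order.TTheory GRing.Theory Num.Theory.
Local Open Scope classical_set_scope.
Local Open Scope ring_scope.

Lemma normr_uL2 (R : realType) (a : R) (t z : nat -> R) (i : nat) (s : R) :
  a != 0 -> t i.-1 < t i ->
  `|uL2 a t z i s| =
  2 / (1 + expR (a * (t i - t i.-1))) * alpha a t z i * expR (a * (t i - s)).
Proof.
(* [expRM_natl] turns e^(2ah) into the square of e^(ah), so that a single exponential remains in the
   two denominators. *)
move=> a0 ti; rewrite /uL2 /alpha -(mulrA 2 a) expRM_natl.
(* Since [a] and the stage length are nonzero, injectivity of exp keeps 1 - e^(ah) away from 0, as
   [field] will require. *)
have E1 : expR (a * (t i - t i.-1)) != 1.
  by rewrite -expR0 (inj_eq (@expR_inj R)) mulf_neq0// subr_eq0 gt_eqF.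
have E0 := expR_gt0 (a * (t i - t i.-1)).
set E := expR (a * (t i - t i.-1)) in E1 E0 *.
set e := expR (a * (t i - s)).
have c0 : 0 <= 2 / (1 + E) by rewrite divr_ge0// addr_ge0// ltW.
have e0 : 0 <= e := expR_ge0 _.
(* The nonnegative factors on the right move under the absolute value; the two arguments are then
   opposite because of the -2 in [uL2], hence [normrN]. *)
rewrite -{1}(ger0_norm c0) -{2}(ger0_norm e0).
rewrite -!normrM -normrN; congr `|_|.
have EN : 1 - E != 0 by rewrite subr_eq0 eq_sym.
have EP : 1 + E != 0 by rewrite gt_eqF// addr_gt0.
have -> : 1 - E ^+ 2 = (1 - E) * (1 + E) by ring.
by field; rewrite EN EP.
Qed.

Theorem proposition3 (R : realType) (N : nat) (t z : nat -> R) (a : R)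
    (t0 : t 0%N = 0)
    (t_incr : forall i : nat, (1 <= i <= N)%N -> t i.-1 < t i)
    (z_neq : forall i : nat, (1 <= i <= N)%N -> z i != z i.-1)
    (a_neq0 : a != 0) :
  forall i : nat, (1 <= i <= N)%N ->
    [/\ a < 0 ->
          is_max_on (stage t i) (fun s => `|uL2 a t z i s|)
            (2 / (1 + expR (a * (t i - t i.-1))) * alpha a t z i),
        0 < a ->
          is_max_on (stage t i) (fun s => `|uL2 a t z i s|)
            (2 * expR (a * (t i - t i.-1)) / (1 + expR (a * (t i - t i.-1)))
             * alpha a t z i)
      & 0 < alpha a t z i ->
          exists2 M : R, is_max_on (stage t i) (fun s => `|uL2 a t z i s|) M
                       & alpha a t z i < M].
Proof.
move=> i iN; have ti := t_incr i iN.
have h0 : 0 < t i - t i.-1 by rewrite subr_gt0.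
have E0 := expR_gt0 (a * (t i - t i.-1)).
have c0 : 0 <= 2 / (1 + expR (a * (t i - t i.-1))) * alpha a t z i.
  by rewrite mulr_ge0 ?normr_ge0// divr_ge0// addr_ge0// ltW.
have max_neg : a < 0 -> is_max_on (stage t i) (fun s => `|uL2 a t z i s|)
    (2 / (1 + expR (a * (t i - t i.-1))) * alpha a t z i).
  move=> a_lt0; split.
    exists (t i); first by rewrite /stage /= in_itv /= lexx ltW.
    by rewrite normr_uL2// subrr mulr0 expR0 mulr1.
  move=> s; rewrite /stage /= in_itv /= => /andP[_ sti].
  (* The coefficient is nonnegative by [c0], so it suffices that e^(a (t i - s)) <= 1 = e^0. *)
  rewrite normr_uL2// ler_piMr// -expR0 ler_expR.
  by rewrite nmulr_rle0// subr_ge0.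
have max_pos : 0 < a -> is_max_on (stage t i) (fun s => `|uL2 a t z i s|)
    (2 * expR (a * (t i - t i.-1)) / (1 + expR (a * (t i - t i.-1)))
     * alpha a t z i).
  (* Moving e^(ah) to the end gives the claimed maximum the exact shape of [normr_uL2] at
     [s = t i.-1]. *)
  move=> a_gt0; rewrite -mulrA mulrAC mulrA; split.
    exists (t i.-1); first by rewrite /stage /= in_itv /= lexx ltW.
    by rewrite normr_uL2.
  move=> s; rewrite /stage /= in_itv /= => /andP[ist _].
  rewrite normr_uL2// ler_wpM2l// ler_expR.
  by rewrite ler_pM2l// lerD2l lerN2.
split=> // alpha_gt0; have [a_lt0|a_gt0|a_eq0] := ltgtP a 0.
- exists (2 / (1 + expR (a * (t i - t i.-1))) * alpha a t z i).
    exact: max_neg.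
  (* Cancelling the positive [alpha] leaves 1 < 2 / (1 + e^(ah)), that is 1 + e^(ah) < 2. *)
  rewrite ltr_pMl// ltr_pdivlMr ?addr_gt0// mul1r.
  suff : expR (a * (t i - t i.-1)) < 1 by lra.
  by rewrite expR_lt1 nmulr_rlt0.
- exists (2 * expR (a * (t i - t i.-1)) / (1 + expR (a * (t i - t i.-1)))
     * alpha a t z i); first exact: max_pos.
  (* The same cancellation now leaves 1 + e^(ah) < 2 e^(ah). *)
  rewrite ltr_pMl// ltr_pdivlMr ?addr_gt0// mul1r.
  suff : 1 < expR (a * (t i - t i.-1)) by lra.
  by rewrite expR_gt1 mulr_gt0.
- by rewrite a_eq0 eqxx in a_neq0.
Qed.
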